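(* Let $G$ be a block graph on $n$ vertices with independence number $\alpha$. Then $\rho(G)\le\rho(P_{n-\alpha+1}^{\alpha-1})$, with equality if and only if $G$ is isomorphic to $P_{n-\alpha+1}^{\alpha-1}$.
   Context: Graphs are finite and simple; $\rho(G)$ is the largest eigenvalue of the adjacency matrix. A block of $G$ is a maximal connected subgraph without a cut vertex of its own; a block graph is a connected graph all of whose blocks are complete graphs. The independence number is the maximum size of a set of pairwise nonadjacent vertices. The pineapple $P_q^p$ is the graph whose vertex set is partitioned into a clique $Q$ on $q$ vertices and an independent set $I$ on $p$ vertices, where every vertex of $I$ is adjacent to the same single vertex of $Q$ (and to no other vertex). *)

(* Defs.v *)
From HB Require Import structures.
From mathcomp Require Import all_boot all_order all_algebra.
From mathcomp Require Import classical_sets reals.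
Set Implicit Arguments.
Unset Strict Implicit.
Unset Printing Implicit Defensive.
Import Order.TTheory GRing.Theory Num.Theory.

Record sgraph := SGraph {
  vertex :> finType;
  adj : rel vertex;
  adj_sym : symmetric adj;
  adj_irrefl : irreflexive adj }.

Definition isomorphic (G H : sgraph) : Prop :=
  exists2 f : G -> H, bijective f & forall x y, adj (f x) (f y) = adj x y.

Definition connected_graph (G : sgraph) : Prop :=
  (0 < #|G|)%N /\ forall x y : G, connect (@adj G) x y.

(* Subgraphs need not be induced. *)
Record subgraph (G : sgraph) := Subgraph {
  verts : {set G};
  edges : rel G;
  edges_sym : symmetric edges;
  edges_sub : forall x y, edges x y -> [&& x \in verts, y \in verts & adj x y] }.

Definition subgraph_le (G : sgraph) (H K : subgraph G) : Prop :=
  verts H \subset verts K /\ subrel (edges H) (edges K).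

Definition sub_connected (G : sgraph) (H : subgraph G) : Prop :=
  verts H != finset.set0 /\
  {in verts H &, forall x y, connect (edges H) x y}.

Definition edges_minus (G : sgraph) (H : subgraph G) (v : G) : rel G :=
  [rel x y | [&& edges H x y, x != v & y != v]].

(* v separates two other vertices of the same component of H. *)
Definition cut_vertex (G : sgraph) (H : subgraph G) (v : G) : Prop :=
  v \in verts H /\
  exists x y : G, [/\ x \in verts H :\ v, y \in verts H :\ v,
    connect (edges H) x y & ~~ connect (edges_minus H v) x y].

Definition nonseparable (G : sgraph) (H : subgraph G) : Prop :=
  sub_connected H /\ forall v, ~ cut_vertex H v.

Definition block (G : sgraph) (B : subgraph G) : Prop :=
  nonseparable B /\
  forall K, nonseparable K -> subgraph_le B K -> subgraph_le K B.

Definition sub_complete (G : sgraph) (H : subgraph G) : Prop :=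
  {in verts H &, forall x y, x != y -> edges H x y}.

Definition block_graph (G : sgraph) : Prop :=
  connected_graph G /\ forall B : subgraph G, block B -> sub_complete B.

Definition independent (G : sgraph) (S : {set G}) : bool :=
  [forall x in S, forall y in S, ~~ adj x y].

Definition independence_number (G : sgraph) : nat :=
  \max_(S : {set G} | independent S) #|S|.

(* The clique is 'I_q, with 0 the common neighbour of the independent set 'I_p;
   the notion is intended for 0 < q. *)
Definition pineapple_adj (q p : nat) : rel ('I_q + 'I_p) := fun x y =>
  match x, y with
  | inl i, inl j => i != j
  | inl i, inr _ => val i == 0%N
  | inr _, inl j => val j == 0%N
  | inr _, inr _ => false
  end.

Lemma pineapple_adj_sym q p : symmetric (@pineapple_adj q p).
Proof. by case=> i [j|j] //=; rewrite eq_sym. Qed.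

Lemma pineapple_adj_irrefl q p : irreflexive (@pineapple_adj q p).
Proof. by case=> i //=; rewrite eqxx. Qed.

Definition pineapple (q p : nat) : sgraph :=
  SGraph (@pineapple_adj_sym q p) (@pineapple_adj_irrefl q p).

Local Open Scope ring_scope.

Definition adjacency_matrix (R : realType) (G : sgraph) : 'M[R]_#|G| :=
  \matrix_(i, j) (adj (enum_val i : G) (enum_val j))%:R.

Definition is_largest_eigenvalue (R : realType) (n : nat) (A : 'M[R]_n)
    (r : R) : Prop :=
  eigenvalue A r /\ forall a : R, eigenvalue A a -> a <= r.

(* A real symmetric matrix of positive size has a largest eigenvalue; the
   default 0 is only relevant for the graph without vertices. *)
Definition rho (R : realType) (G : sgraph) : R :=
  xget 0 [set r | is_largest_eigenvalue (adjacency_matrix R G) r]%classic.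

(* Main.v *)
(* Let [S] be a maximum independent set. The bipartite graph between [S] and its
   complement [C] is a forest, since a block graph has no cycle containing two
   nonadjacent vertices. For a vector [z >= 0] whose maxima over [C] and [S] are
   attained at [r] and [s], root the graph at [r] and charge every edge of the
   forest to its deeper end: this bounds the quadratic form of [G] at [z] by
   that of the pineapple with clique [s |: C] and centre [r]. Taking [z] to be
   the absolute value of an eigenvector gives the inequality. In the equality
   case [z] is a multiple of the positive eigenvector of the pineapple, whose
   values on the centre, the rest of the clique and the pendant vertices differ
   (up to degenerate cases), so that every charged edge is a pineapple edge. *)
Require Import Defs.
From mathcomp Require Import boolp classical_sets.
From mathcomp Require Import all_boot all_order all_algebra.
From mathcomp Require Import reals.
From mathcomp Require Import zify ring lra.
Set Implicit Arguments.
Unset Strict Implicit.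
Unset Printing Implicit Defensive.
Import Order.TTheory GRing.Theory Num.Theory.
Local Open Scope ring_scope.

(** * Blocks and breadth-first depth in block graphs *)

Lemma induced_edges_sym (G : sgraph) (U : {set G}) :
  symmetric [rel x y | [&& x \in U, y \in U & adj x y]].
Proof. by move=> x y; rewrite /= adj_sym andbCA. Qed.

Definition induced (G : sgraph) (U : {set G}) : subgraph G :=
  Subgraph (induced_edges_sym U) (fun x y h => h).

(* Rotating the cycle to start at a vertex [v] shows that the other vertices
   are joined by a path avoiding [v]. *)
Lemma cycle_nonseparable (G : sgraph) (c : seq G) :
  c != [::] -> uniq c -> cycle (@adj G) c ->
  nonseparable (induced [set x in c]).
Proof.
move=> c_neq0 uc cc; split; last first.
  move=> v [/= vc [x [y [xc yc _ /negP[]]]]].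
  rewrite inE in vc; have [i c' rc] := rot_to vc.
  have memc z : (z \in [set z in c] :\ v) = (z \in c').
    have: uniq (v :: c') by rewrite -rc rot_uniq.
    rewrite !inE -(mem_rot i) rc inE => /andP[vc' _].
    by case: eqVneq => //= ->; rewrite (negPf vc').
  rewrite !memc in xc yc.
  have symE : connect_sym (edges_minus (induced [set x in c]) v).
    apply: sym_connect_sym => a b; rewrite /edges_minus [RHS]/= [LHS]/=.
    rewrite [adj b a]adj_sym [(a != v) && _]andbC.
    by congr andb; rewrite andbCA.
  have : cycle (@adj G) (v :: c') by rewrite -rc rot_cycle.
  case: c' memc xc yc {rc} => // w p memc xc yc /= /andP[_].
  rewrite rcons_path => /andP[wp _].
  have wp' : path (edges_minus (induced [set x in c]) v) w p.
    apply: (sub_in_path (P := [in w :: p])) wp; last by apply/allP.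
    move=> a b aw bw ab; rewrite /edges_minus /= ab; move: aw bw.
    by rewrite -!memc !inE => /andP[-> ->] /andP[-> ->].
  apply: connect_trans (path_connect wp' yc).
  by rewrite symE; apply: path_connect wp' _ xc.
split.
  case: c c_neq0 {uc cc} => // v c _.
  by apply/set0Pn; exists v; rewrite !inE eqxx.
have cc' : cycle (edges (induced [set x in c])) c.
  apply: (sub_in_cycle (P := [in c])) cc; last by apply/allP.
  by move=> a b /= ac bc; rewrite !inE ac bc.
by move=> x y /=; rewrite !inE; apply: connect_cycle cc' x y.
Qed.

(** Induction on the room left for [mu], which counts vertices and ordered edges: if [K] is not
    maximal, a nonseparable subgraph that properly extends it has larger [mu], since equal counts
    would force the reverse inclusion. *)
Lemma nonseparable_block (G : sgraph) (K : subgraph G) :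
  nonseparable K -> exists2 B, block B & subgraph_le K B.
Proof.
pose mu (H : subgraph G) := (#|verts H| + #|[set e | edges H e.1 e.2]|)%N.
have mu_max (H : subgraph G) : (mu H <= #|G| + #|{: G * G}|)%N.
  by rewrite leq_add ?max_card.
have [k] := ubnP (#|G| + #|{: G * G}| - mu K)%N.
elim: k K => // k IH K ltk nsK.
have [maxK | ] := pselect (forall K',
    nonseparable K' -> subgraph_le K K' -> subgraph_le K' K).
  by exists K; split.
move=> /existsNP[K' /not_implyP[nsK' /not_implyP[leK nleK]]].
have ltmu : (mu K < mu K')%N.
  have [leV leE] := leK.
  have leE' : [set e | edges K e.1 e.2] \subset [set e | edges K' e.1 e.2].
    by apply/subsetP=> e; rewrite !inE; apply: leE.
  have cV := subset_leq_card leV; have cE := subset_leq_card leE'.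
  rewrite ltnNge; apply/negP => ge; apply: nleK.
  have eV : verts K = verts K'.
    apply/eqP; rewrite eqEcard leV -(leq_add2r #|[set e | edges K e.1 e.2]|).
    by rewrite (leq_trans _ ge) ?leq_add2l.
  have eE : [set e | edges K e.1 e.2] = [set e | edges K' e.1 e.2].
    apply/eqP; rewrite eqEcard leE' -(leq_add2l #|verts K|).
    by rewrite (leq_trans _ ge) ?leq_add2r.
  split; first by rewrite eV.
  by move=> x y xy; move/setP/(_ (x, y)): eE; rewrite !inE /= xy.
have [|B blB leB] := IH K' _ nsK'.
  by move: (mu_max K') ltk ltmu; lia.
exists B => //; split; first exact: subset_trans leK.1 leB.1.
by move=> x y /leK.2 /leB.2.
Qed.

Definition avoiding (G : sgraph) (v : G) : rel G :=
  [rel x y | [&& adj x y, x != v & y != v]].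

Lemma avoiding_sym (G : sgraph) (v : G) : symmetric (avoiding v).
Proof. by move=> x y; rewrite /avoiding /= adj_sym [(y != v) && _]andbC. Qed.

(** A simple path from [x] to [y] avoiding [v] closes up through [v] to a cycle; the cycle lies in a
    block, and blocks are complete. *)
Lemma block_graph_closes (G : sgraph) (v x y : G) : block_graph G ->
  adj v x -> adj v y -> x != y -> connect (avoiding v) x y -> adj x y.
Proof.
move=> [_ blG] vx vy neq_xy /connectP[p0 p0P yE].
move: yE; case/shortenP: p0P => p avp up _ yE.
have xp : path (@adj G) x p by apply: sub_path avp => a b /andP[].
have vp : v \notin x :: p.
  rewrite inE negb_or; apply/andP; split.
    by apply: contraTneq vx => ->; rewrite adj_irrefl.
  elim: p x avp {vx yE neq_xy up xp} => //= w p IH x /andP[/and3P[_ _ wv] wp].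
  by rewrite inE negb_or eq_sym wv (IH w).
have cyc : cycle (@adj G) (v :: x :: p).
  by rewrite /= vx rcons_path xp -yE adj_sym.
have [B /blG cB [leV leE]] :
    exists2 B, block B & subgraph_le (induced [set z in v :: x :: p]) B.
  by apply/nonseparable_block/cycle_nonseparable; rewrite // cons_uniq vp.
have /edges_sub /and3P[] // : edges B x y.
apply: cB => //; apply: (subsetP leV); rewrite !inE ?eqxx ?orbT //.
by rewrite -in_cons yE mem_last !orbT.
Qed.

(** The distance from [r], given by its local properties: the root, a parent for every other vertex,
    and growth by at most one along an edge. *)
Definition bfs_depth (T : finType) (e : rel T) (r : T) (d : T -> nat) :=
  [/\ forall v, (d v == 0%N) = (v == r),
      forall v, v != r -> exists2 u, e u v & (d u).+1 = d v &
      forall u v, e u v -> (d v <= (d u).+1)%N].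

Lemma bfs_depth_exists (T : finType) (e : rel T) (r : T) :
  (forall v, connect e r v) -> exists d, bfs_depth e r d.
Proof.
move=> conn.
(* Quantifying over tuples makes the predicate boolean, so that [ex_minn] can pick the least path
   length. *)
pose at_dist v n := [exists t : n.-tuple T, path e r t && (last r t == v)].
have ex v : exists n, at_dist v n.
  have /connectP[p rp ->] := conn v; exists (size p).
  by apply/existsP; exists (in_tuple p); rewrite rp /=.
pose d v := ex_minn (ex v).
have dP v p : path e r p -> last r p = v -> (d v <= size p)%N.
  move=> rp lp; rewrite /d; case: ex_minnP => m _; apply.
  by apply/existsP; exists (in_tuple p); rewrite rp /= lp.
have dE v : exists p, [/\ path e r p, last r p = v & size p = d v].
  rewrite /d; case: ex_minnP => m /existsP[t /andP[rt /eqP lt]] _.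
  by exists t; rewrite size_tuple.
exists d; split=> [v | v | u v uv].
- apply/eqP/eqP => [dv0 | ->]; last by apply/eqP; rewrite -leqn0 (dP r [::]).
  by have [p [_ lp]] := dE v; rewrite dv0 -lp => /size0nil ->.
- have [p] := dE v; case/lastP: p => [[_ <-] | p w]; first by rewrite eqxx.
  rewrite last_rcons rcons_path => -[/andP[rp lw] wv sz] _.
  subst w; exists (last r p) => //; apply/eqP.
  rewrite eqn_leq -{1}sz size_rcons ltnS dP //=.
  have [q [rq lq <-]] := dE (last r p).
  rewrite -(size_rcons q v); apply: dP; rewrite ?last_rcons //.
  by rewrite rcons_path rq lq.
have [p [rp lp <-]] := dE u.
rewrite -(size_rcons p v); apply: dP; rewrite ?last_rcons //.
by rewrite rcons_path rp lp.
Qed.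

Section BlockGraphDepth.
Variables (G : sgraph) (r : G) (d : G -> nat).
Hypotheses (blG : block_graph G) (dP : bfs_depth (@adj G) r d).

(** Climb from parent to parent: after the first step the depth is strictly below that of [v], so
    [v] is never met. *)
Lemma connect_root_avoiding v x :
  (d x <= d v)%N -> x != v -> connect (avoiding v) x r.
Proof.
have [d0 dS _] := dP; move: {2}(d x) (leqnn (d x)) => k.
elim: k x => [|k IH] x.
  by rewrite leqn0 d0 => /eqP ->.
have [-> // | xr] := eqVneq x r.
have [u ux <-] := dS x xr; rewrite ltnS => duk dv xv.
have uv : u != v by apply: contraTneq dv => ->; rewrite ltnn.
apply: connect_trans (IH u duk (ltnW dv) uv).
by apply: connect1; rewrite /avoiding /= adj_sym ux xv.
Qed.

(** Both neighbours reach the root outside [v], hence are joined to each other outside [v]. *)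
Lemma shallow_neighbours_adj v x y : adj v x -> adj v y -> x != y ->
  (d x <= d v)%N -> (d y <= d v)%N -> adj x y.
Proof.
move=> vx vy xy dx dy; apply: (block_graph_closes blG vx vy xy).
have neq w : adj v w -> w != v.
  by apply: contraTneq => ->; rewrite adj_irrefl.
apply: connect_trans (connect_root_avoiding dx (neq _ vx)) _.
rewrite (sym_connect_sym (@avoiding_sym G v)).
exact: connect_root_avoiding dy (neq _ vy).
Qed.

(* Two parents [x], [y] of [v] would be adjacent, hence share a parent [u];
   then [v] and [u] are joined outside [x] through [y], so they are adjacent
   although their depths differ by two. *)
Lemma parent_unique v x y : adj v x -> adj v y ->
  (d x < d v)%N -> (d y < d v)%N -> x = y.
Proof.
have [d0 dS d1] := dP; move=> vx vy dx dy; apply/eqP/negPn/negP => xy.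
have axy : adj x y by apply: shallow_neighbours_adj vx vy xy _ _; apply: ltnW.
have := d1 x v; rewrite adj_sym vx => /(_ isT) dvx.
have := d1 y v; rewrite adj_sym vy => /(_ isT) dvy.
have xr : x != r.
  apply: contra xy => /eqP xr; rewrite xr eq_sym -d0.
  by move: (d0 r) dx dvx dvy dy; rewrite -xr eqxx; lia.
have [u ux dux] := dS x xr; rewrite adj_sym in ux.
have uy : u != y by apply: contraTneq dvy => <-; rewrite -ltnNge; lia.
have auy : adj u y.
  by apply: shallow_neighbours_adj ux axy uy _ _; lia.
have uv : u != v by apply/eqP => uv; move: dx; rewrite -dux uv; lia.
have neq w : adj x w -> w != x.
  by apply: contraTneq => ->; rewrite adj_irrefl.
have avu : adj v u.
  rewrite adj_sym in vx.
  apply: (block_graph_closes blG vx ux); rewrite 1?eq_sym //.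
  by apply: (@connect_trans _ _ y); apply: connect1;
    rewrite /avoiding /= ?vy 1?adj_sym ?auy !neq.
have := d1 u v; rewrite adj_sym avu => /(_ isT); lia.
Qed.

End BlockGraphDepth.

(** * Spectral radius and quadratic forms *)

(** Eigenvectors as functions on vertices, free of the enumeration that indexes the matrix. *)
Definition eigenfunction (R : realType) (G : sgraph) (a : R) (y : G -> R) :=
  forall u, \sum_v (adj u v)%:R * y v = a * y u.

Lemma adjacency_eigenvalueP (R : realType) (G : sgraph) (a : R) :
  eigenvalue (adjacency_matrix R G) a <->
  exists2 y : G -> R, eigenfunction a y & exists v, y v != 0.
Proof.
have reidx (F : G -> R) : \sum_v F v = \sum_(i < #|G|) F (enum_val i).
  by rewrite -(big_enum_val F); apply: eq_bigl.
split=> [/eigenvalueP[v vA v0] | [y yA [u yu]]].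
  exists (fun u => v 0 (enum_rank u)) => [u|].
    have := congr1 (fun w : 'rV_ _ => w 0 (enum_rank u)) vA.
    rewrite !mxE reidx => <-; apply: eq_bigr => i _.
    by rewrite !mxE !enum_rankK enum_valK adj_sym mulrC.
  have /rV0Pn[i vi] := v0.
  by exists (enum_val i); rewrite enum_valK.
apply/eigenvalueP; exists (\row_i y (enum_val i)); last first.
  by apply/rV0Pn; exists (enum_rank u); rewrite mxE enum_rankK.
apply/rowP => j; rewrite !mxE -yA reidx; apply: eq_bigr => i _.
by rewrite !mxE adj_sym mulrC.
Qed.

Lemma rho_isomorphic (R : realType) (G H : sgraph) :
  isomorphic G H -> rho R G = rho R H.
Proof.
move=> [f [g fK gK] fA].
have eigE a : eigenvalue (adjacency_matrix R G) a =
              eigenvalue (adjacency_matrix R H) a.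
  have bij_f : bijective f by exists g.
  have bij_g : bijective g by exists f.
  apply/idP/idP => /adjacency_eigenvalueP[y yA [v yv]];
    apply/adjacency_eigenvalueP.
    exists (y \o g) => [u|]; last by exists (f v); rewrite /= fK.
    rewrite /= -yA (reindex f) /=; last exact: onW_bij.
    by apply: eq_bigr => w _; rewrite -{1}(gK u) fA fK.
  exists (y \o f) => [u|]; last by exists (g v); rewrite /= gK.
  rewrite /= -yA [RHS](reindex f) /=; last exact: onW_bij.
  by apply: eq_bigr => w _; rewrite fA.
(* [rho] is chosen from a set, so the two sets of largest eigenvalues have to be shown equal. *)
rewrite /rho; congr xget; apply/funext => r /=; apply/propext.
rewrite /is_largest_eigenvalue eigE; split=> -[? le]; split=> // a.
  by rewrite -eigE; apply: le.
by rewrite eigE; apply: le.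
Qed.

(** The sum runs over ordered pairs, so every edge counts twice. *)
Definition quad_form (R : realType) (T : finType) (e : rel T) (z : T -> R) :=
  \sum_u \sum_v (e u v)%:R * (z u * z v).

Lemma eigenfunction_quad_form (R : realType) (G : sgraph) a (y : G -> R) :
  eigenfunction a y -> quad_form (@adj G) y = a * \sum_u y u ^+ 2.
Proof.
move=> yA; rewrite mulr_sumr; apply: eq_bigr => u _.
rewrite expr2 mulrA -yA mulr_suml; apply: eq_bigr => v _; ring.
Qed.

Lemma quad_form_norm (R : realType) (T : finType) (e : rel T) (z : T -> R) :
  quad_form e z <= quad_form e (fun v => `|z v|).
Proof.
apply: ler_sum => u _; apply: ler_sum => v _.
by rewrite -normrM ler_wpM2l ?ler_norm ?ler0n.
Qed.

(** Expand the square: by the eigenvalue equation each of the two pure terms sums to [a] times the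
    squared norm of [w * x], and the cross term is the quadratic form. *)
Lemma rayleigh_defect (R : realType) (T : finType) (e : rel T)
    (x w : T -> R) (a : R) : symmetric e ->
  (forall u, \sum_v (e u v)%:R * x v = a * x u) ->
  \sum_u \sum_v (e u v)%:R * (x u * x v * (w u - w v) ^+ 2) =
  2 * (a * \sum_u (w u * x u) ^+ 2 - quad_form e (fun v => w v * x v)).
Proof.
move=> e_sym xA.
have sqE : \sum_u \sum_v (e u v)%:R * (x u * x v * w u ^+ 2) =
           a * \sum_u (w u * x u) ^+ 2.
  rewrite mulr_sumr; apply: eq_bigr => u _.
  transitivity (x u * w u ^+ 2 * \sum_v (e u v)%:R * x v); last first.
    by rewrite xA; ring.
  by rewrite mulr_sumr; apply: eq_bigr => v _; ring.
have sqE' : \sum_u \sum_v (e u v)%:R * (x u * x v * w v ^+ 2) =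
           a * \sum_u (w u * x u) ^+ 2.
  rewrite -sqE exchange_big /=; apply: eq_bigr => u _; apply: eq_bigr => v _.
  by rewrite e_sym; ring.
have -> (N q : R) : 2 * (N - q) = N + N - 2 * q by ring.
rewrite -{1}sqE -sqE' /quad_form mulr_sumr -big_split -sumrB.
apply: eq_bigr => u _ /=.
by rewrite mulr_sumr -big_split -sumrB; apply: eq_bigr => v _ /=; ring.
Qed.

(** With [w = z / x] and [x] positive, the defect is a sum of nonnegative terms. Hence an eigenvalue
    with a positive eigenfunction is the largest one. *)
Lemma rayleigh_le (R : realType) (T : finType) (e : rel T)
    (x z : T -> R) (a : R) : symmetric e -> (forall v, 0 < x v) ->
  (forall u, \sum_v (e u v)%:R * x v = a * x u) ->
  quad_form e z <= a * \sum_u z u ^+ 2.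
Proof.
move=> e_sym x0 xA.
have zE : z = (fun v => z v / x v * x v).
  by apply/funext => v; rewrite divfK ?gt_eqF.
rewrite zE -subr_ge0 -(pmulr_rge0 _ (ltr0Sn _ 1)).
rewrite -(rayleigh_defect (fun v => z v / x v)) //.
apply: sumr_ge0 => u _; apply: sumr_ge0 => v _.
by rewrite mulr_ge0 ?ler0n // mulr_ge0 ?sqr_ge0 // mulr_ge0 ?(ltW (x0 _)).
Qed.

(** In the extremal case every square in the defect vanishes. *)
Lemma rayleigh_eq (R : realType) (T : finType) (e : rel T)
    (x z : T -> R) (a : R) : symmetric e -> (forall v, 0 < x v) ->
  (forall u, \sum_v (e u v)%:R * x v = a * x u) ->
  a * \sum_u z u ^+ 2 <= quad_form e z ->
  forall u v, e u v -> z u / x u = z v / x v.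
Proof.
move=> e_sym x0 xA ge u v uv.
have zE : z = (fun v => z v / x v * x v).
  by apply/funext => ?; rewrite divfK ?gt_eqF.
have term0 u' v' :
    0 <= (e u' v')%:R * (x u' * x v' * (z u' / x u' - z v' / x v') ^+ 2).
  by rewrite mulr_ge0 ?ler0n // mulr_ge0 ?sqr_ge0 // mulr_ge0 ?(ltW (x0 _)).
have le0 : \sum_u \sum_v
    (e u v)%:R * (x u * x v * (z u / x u - z v / x v) ^+ 2) <= 0.
  rewrite (@rayleigh_defect _ _ _ _ (fun v => z v / x v) a) // -zE.
  rewrite pmulr_rle0 // subr_le0 (le_trans _ ge) //.
  by under eq_bigr do rewrite divfK ?gt_eqF //.
move: le0; rewrite le_eqVlt ltNge sumr_ge0 ?orbF; last first.
  by move=> i _; apply: sumr_ge0.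
rewrite psumr_eq0; last by move=> i _; apply: sumr_ge0.
move=> /allP/(_ u (mem_index_enum _)) /=; rewrite psumr_eq0 //.
move=> /allP/(_ v (mem_index_enum _)) /=.
rewrite uv mul1r mulf_eq0 sqrf_eq0 mulf_eq0 !(gt_eqF (x0 _)) /=.
by rewrite subr_eq0 => /eqP.
Qed.

(** * Pineapples and their positive eigenfunctions *)

(** The pineapple with clique [Q] and centre [r] laid on a given vertex set, so that its form and
    that of [G] can be evaluated at the same vector. *)
Definition pineapple_rel (T : finType) (Q : {set T}) (r : T) : rel T :=
  [rel x y | (x != y) && [|| (x \in Q) && (y \in Q), x == r | y == r]].

Lemma pineapple_rel_sym (T : finType) (Q : {set T}) (r : T) :
  symmetric (pineapple_rel Q r).
Proof.
move=> x y; rewrite /pineapple_rel /= eq_sym [(y \in Q) && _]andbC.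
by rewrite [(y == r) || _]orbC.
Qed.

Lemma pineapple_rel_isomorphic (G : sgraph) (Q : {set G}) (r : G) (q p : nat) :
  r \in Q -> #|Q| = q -> #|~: Q| = p ->
  (forall x y : G, adj x y = pineapple_rel Q r x y) ->
  isomorphic G (pineapple q p).
Proof.
move=> rQ cQ cI adjE.
(* [r] is listed first because the centre of [pineapple] has index 0. *)
pose l1 := r :: enum (Q :\ r); pose l2 := enum (~: Q).
have s1 : size l1 = q by rewrite /= -cardE -cQ (cardsD1 r Q) rQ.
have s2 : size l2 = p by rewrite -cardE.
have u1 : uniq l1 by rewrite /= enum_uniq mem_enum !inE eqxx.
have m1 x : x \in l1 -> x \in Q.
  by rewrite inE mem_enum !inE => /predU1P[-> | /andP[]].
have m2 x : x \in l2 -> x \notin Q by rewrite mem_enum inE.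
pose g (u : pineapple q p) : G :=
  match u with inl i => nth r l1 i | inr j => nth r l2 j end.
have g1 i : g (inl i) \in Q by rewrite m1 // mem_nth // s1.
have g2 j : g (inr j) \notin Q by rewrite m2 // mem_nth // s2.
have g_inj : injective g.
  move=> [i | i] [j | j] gE.
  - by move/eqP: gE; rewrite /= (nth_uniq _ _ _ u1) ?s1 // => /eqP/val_inj ->.
  - by move: (g1 i) (g2 j); rewrite gE => ->.
  - by move: (g1 j) (g2 i); rewrite gE => ->.
  move/eqP: gE; rewrite /= (nth_uniq _ _ _ (enum_uniq _)) ?s2 //.
  by move=> /eqP/val_inj ->.
have g_bij : bijective g.
  by apply: inj_card_bij g_inj _; rewrite card_sum !card_ord -cQ -cI cardsC.
have gr i : (g (inl i) == r) = (val i == 0%N).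
  by rewrite -[X in _ == X]/(nth r l1 0) nth_uniq ?s1 // -s1.
have gr2 j : (g (inr j) == r) = false.
  by apply: contraNF (g2 j) => /eqP ->.
have gA u v : adj (g u) (g v) = pineapple_adj u v.
  rewrite adjE /pineapple_rel /= (inj_eq g_inj).
  by case: u v => [i | i] [j | j];
    rewrite ?g1 ?(negPf (g2 _)) ?gr ?gr2 /= ?orbF ?andbT ?andbF.
have [f gK fK] := g_bij.
by exists f => [|x y]; [exists g | rewrite -[LHS]gA !fK].
Qed.

Definition pineapple_clique (q p : nat) : {set pineapple q p} :=
  [set u | if u is inl _ then true else false].

Lemma pineapple_adjE (q p : nat) (x y : pineapple q.+1 p) :
  adj x y = pineapple_rel (pineapple_clique q.+1 p) (inl ord0) x y.
Proof.
have E1 (i : 'I_q.+1) :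
  (inl i == inl ord0 :> pineapple q.+1 p) = (val i == 0%N) by [].
have E2 (i : 'I_p) : (inr i == inl ord0 :> pineapple q.+1 p) = false by [].
by case: x y => [i | i] [j | j];
  rewrite /pineapple_rel /= !inE ?E1 ?E2 ?orbT ?andbT ?andbF ?orbF.
Qed.

Section PineappleEigenfunction.
Variables (R : realType) (m p : nat) (a b c mu : R).
Hypotheses (muQ : mu * a = m%:R * a + c) (muI : mu * b = c)
  (muC : mu * c = m.+1%:R * a + p%:R * b).

(** Constant on the three kinds of vertices: [c] at the centre, [a] on the rest of the clique, [b]
    on the pendant vertices. The section hypotheses are the eigenvalue equations at these vertices
    for clique size [m.+2]. *)
Definition pineapple_weight (T : finType) (Q : {set T}) (r : T) (v : T) : R :=
  if v == r then c else if v \in Q then a else b.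

Lemma pineapple_weight_eigen (T : finType) (Q : {set T}) (r : T) :
  r \in Q -> #|Q| = m.+2 -> #|~: Q| = p ->
  forall u, \sum_v (pineapple_rel Q r u v)%:R * pineapple_weight Q r v =
            mu * pineapple_weight Q r u.
Proof.
move=> rQ cQ cI u.
have split3 (F : T -> R) :
    \sum_v F v = F r + \sum_(v in Q :\ r) F v + \sum_(v in ~: Q) F v.
  rewrite (bigD1 r) //= -addrA (bigID (mem Q)) /=; congr (_ + (_ + _)).
    by apply: eq_bigl => v; rewrite !inE.
  apply: eq_bigl => v; rewrite !inE andbC.
  by case: eqVneq => [->|]; rewrite ?rQ ?andbT.
have cQr : #|Q :\ r| = m.+1 by apply: succn_inj; rewrite -cQ (cardsD1 r Q) rQ.
rewrite split3.
have -> : \sum_(v in Q :\ r)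
            (pineapple_rel Q r u v)%:R * pineapple_weight Q r v =
          \sum_(v in Q :\ r) (pineapple_rel Q r u v)%:R * a.
  by apply: eq_bigr => v; rewrite /pineapple_weight !inE => /andP[/negPf -> ->].
have -> : \sum_(v in ~: Q)
            (pineapple_rel Q r u v)%:R * pineapple_weight Q r v =
          \sum_(v in ~: Q) (pineapple_rel Q r u v)%:R * b.
  apply: eq_bigr => v; rewrite /pineapple_weight !inE => vQ; rewrite (negPf vQ).
  by case: eqP vQ => // ->; rewrite rQ.
have wr : pineapple_weight Q r r = c by rewrite /pineapple_weight eqxx.
rewrite wr.
have relC v : pineapple_rel Q r r v = (v != r).
  by rewrite /pineapple_rel /= eqxx orbT andbT eq_sym.
have [-> | ur] := eqVneq u r.
  rewrite relC wr eqxx mul0r add0r muC; congr (_ + _).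
    rewrite (eq_bigr (fun=> a)) ?sumr_const ?cQr ?mulr_natl // => v.
    by rewrite relC !inE => /andP[-> _]; rewrite mul1r.
  rewrite (eq_bigr (fun=> b)) ?sumr_const ?cI ?mulr_natl // => v.
  by rewrite relC !inE; case: eqP => [->|]; rewrite ?rQ ?mul1r.
have -> : pineapple_rel Q r u r by rewrite /pineapple_rel /= ur eqxx !orbT.
rewrite mul1r /pineapple_weight (negPf ur).
case: ifP => uQ.
  rewrite muQ addrC [RHS]addrC; rewrite [X in X + _]big1 ?add0r; last first.
    move=> v; rewrite !inE => vQ.
    have vr : (v == r) = false by apply: contraNF vQ => /eqP ->.
    by rewrite /pineapple_rel /= (negPf vQ) (negPf ur) vr !andbF mul0r.
  congr (_ + _); rewrite (bigD1 u) /=; last by rewrite !inE ur.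
  rewrite /pineapple_rel /= eqxx mul0r add0r (eq_bigr (fun=> a)); last first.
    move=> v; rewrite !inE => /andP[/andP[_ vQ] vu].
    by rewrite eq_sym vu uQ vQ mul1r.
  rewrite sumr_const mulr_natl; congr (_ *+ _).
  apply: succn_inj; rewrite -cQr (cardsD1 u (Q :\ r)) !inE ur uQ.
  by congr _.+1; apply: eq_card => v; rewrite !inE unfold_in /= !inE andbC.
rewrite !big1 ?addr0 // => v; rewrite !inE => vQ.
  have vr : (v == r) = false by apply: contraNF vQ => /eqP ->.
  by rewrite /pineapple_rel /= uQ (negPf ur) vr andbF mul0r.
case/andP: vQ => /negPf vr _.
by rewrite /pineapple_rel /= uQ (negPf ur) vr andbF mul0r.
Qed.

End PineappleEigenfunction.

Lemma pineapple_weights_exist (R : realType) (m p : nat) :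
  exists a b c mu : R, [/\ [/\ 0 < a, 0 < b, 0 < c & 0 < mu],
    mu * a = m%:R * a + c, mu * b = c & mu * c = m.+1%:R * a + p%:R * b].
Proof.
pose M : R := m%:R; pose P : R := p%:R.
have M0 : 0 <= M by rewrite ler0n.
have P0 : 0 <= P by rewrite ler0n.
(* Normalising [c = 1] gives [b = 1 / t] and [a = 1 / (t - M)]; clearing denominators in the
   equation at the centre leaves this cubic. *)
pose f : {poly R} := 'X^2 * ('X - M%:P) - (M + 1)%:P * 'X - P%:P * ('X - M%:P).
have fE t : f.[t] = t ^+ 2 * (t - M) - (M + 1) * t - P * (t - M).
  by rewrite /f !hornerE.
(* The cubic equals [- P] at the left end and is nonnegative at the right end. A root that is at
   least [M + 1] makes [t] and [t - M] positive. *)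
have [||t tI /rootP ft] := @poly_ivt R f (M + 1) (M + 1 + P).
- by rewrite lerDl.
- by rewrite !fE; apply/andP; split; nra.
have {tI} /andP[tM _] := tI.
have t0 : 0 < t by lra.
have tM0 : 0 < t - M by lra.
exists (t - M)^-1, t^-1, 1, t; split.
- by rewrite !invr_gt0.
- by field; lra.
- by field; lra.
move: ft; rewrite fE -natr1 -/M -/P => ft.
have -> : t * 1 = (t ^+ 2 * (t - M)) / (t * (t - M)) by field; lra.
have -> : t ^+ 2 * (t - M) = (M + 1) * t + P * (t - M) by lra.
by field; lra.
Qed.

(** The weights form a positive eigenfunction for [mu], so the Rayleigh bound applies to every other
    eigenvalue. *)
Lemma pineapple_rho (R : realType) (m p : nat) (a b c mu : R) :
  0 < a -> 0 < b -> 0 < c ->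
  mu * a = m%:R * a + c -> mu * b = c -> mu * c = m.+1%:R * a + p%:R * b ->
  rho R (pineapple m.+2 p) = mu.
Proof.
move=> a0 b0 c0 muQ muI muC.
pose Q := pineapple_clique m.+2 p.
pose r : pineapple m.+2 p := inl ord0.
have rQ : r \in Q by rewrite inE.
have cQ : #|Q| = m.+2.
  rewrite -[RHS](card_ord m.+2) -(card_imset _ (@inl_inj 'I_m.+2 'I_p)).
  apply: eq_card => -[i|i]; rewrite !inE; apply/esym.
    by apply/imsetP; exists i.
  by apply/negP => /imsetP[].
have cI : #|~: Q| = p.
  by apply/eqP; rewrite -(eqn_add2l #|Q|) cardsC cQ card_sum !card_ord.
pose x := pineapple_weight a b c Q r.
have x0 v : 0 < x v by rewrite /x /pineapple_weight; do 2?case: ifP => _.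
have xA : eigenfunction mu x.
  move=> u; rewrite -(pineapple_weight_eigen muQ muI muC rQ cQ cI).
  by apply: eq_bigr => v _; rewrite pineapple_adjE.
have muP : is_largest_eigenvalue (adjacency_matrix R (pineapple m.+2 p)) mu.
  split.
    by apply/adjacency_eigenvalueP; exists x => //; exists r; rewrite gt_eqF.
  move=> t /adjacency_eigenvalueP[y yA [v yv]].
  have y2 : 0 < \sum_u y u ^+ 2.
    rewrite (bigD1 v) //= ltr_wpDr ?exprn_even_gt0 //.
    by apply: sumr_ge0 => u _; rewrite sqr_ge0.
  rewrite -(ler_pM2r y2) -(eigenfunction_quad_form yA).
  exact: rayleigh_le (@adj_sym _) x0 xA.
apply: xget_unique => // t [tE tM]; apply/eqP; rewrite eq_le.
by rewrite muP.2 // tM // muP.1.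
Qed.

(** * Charging edges to endpoints *)

Lemma ler_sum_eq (R : realType) (I : finType) (F1 F2 : I -> R) :
  (forall i, F1 i <= F2 i) -> \sum_i F2 i <= \sum_i F1 i ->
  forall i, F1 i = F2 i.
Proof.
move=> le12; rewrite -subr_ge0 -sumrB => ge0 i.
have: \sum_i (F2 i - F1 i) == 0.
  rewrite eq_le (sumr_ge0 _ (fun j _ => _)) ?andbT; last first.
    by move=> j; rewrite subr_ge0.
  rewrite -oppr_ge0 -sumrN (eq_bigr (fun i => F1 i - F2 i)) // => j _.
  by rewrite opprB.
rewrite psumr_eq0 => [/allP/(_ i (mem_index_enum _))|j _]; last first.
  by rewrite subr_ge0.
by rewrite /= subr_eq0 => /eqP.
Qed.

Lemma natr_bool_inj (R : numDomainType) (b c : bool) :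
  b%:R = c%:R :> R -> b = c.
Proof. by move/eqP; rewrite eqr_nat; case: b; case: c. Qed.

Section IndicatorSums.
Variables (R : realType) (T : finType) (z : T -> R).

Lemma sum_indicator_unique (h : pred T) v :
  (forall w, h w -> w = v) -> h v -> \sum_w (h w)%:R * z w = z v.
Proof.
move=> uh hv; rewrite (bigD1 v) //= hv mul1r big1 ?addr0 // => w.
by case: (boolP (h w)) => [/uh -> | _]; rewrite ?eqxx ?mul0r.
Qed.

(** As [h] holds at one point at most, the left sum is 0 or a single value, which one term on the
    right dominates. *)
Lemma sum_indicator_le (h k : pred T) : (forall v, 0 <= z v) ->
  (forall v w, h v -> h w -> v = w) ->
  (forall v, h v -> exists2 w, k w & z v <= z w) ->
  \sum_v (h v)%:R * z v <= \sum_v (k v)%:R * z v.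
Proof.
move=> z0 uh hk.
have term0 v : 0 <= (k v)%:R * z v by rewrite mulr_ge0 ?ler0n.
have [v hv | h0] := pickP h; last first.
  rewrite big1 ?sumr_ge0 // => v _.
  by rewrite h0 mul0r.
have [w kw le] := hk v hv.
rewrite (@sum_indicator_unique h v) // => [|u hu]; last exact: uh.
by rewrite (bigD1 w) //= kw mul1r (le_trans le) // lerDl sumr_ge0.
Qed.

(** [h] orients the edges outside [k]; both orientations contribute equally, whence the factor 2. *)
Lemma quad_form_charged (e k h : rel T) :
  (forall u v, (e u v)%:R = (k u v)%:R + (h u v)%:R + (h v u)%:R :> R) ->
  quad_form e z =
  quad_form k z + 2 * \sum_u z u * \sum_v (h u v)%:R * z v.
Proof.
move=> eE; pose H := \sum_u \sum_v (h u v)%:R * (z u * z v).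
have HE : \sum_u z u * \sum_v (h u v)%:R * z v = H.
  apply: eq_bigr => u _; rewrite mulr_sumr; apply: eq_bigr => v _; ring.
have HE' : H = \sum_u \sum_v (h v u)%:R * (z u * z v).
  rewrite /H exchange_big; apply: eq_bigr => u _; apply: eq_bigr => v _ /=; ring.
rewrite HE mulr_natl mulr2n {2}HE' /quad_form /H -!big_split /=.
apply: eq_bigr => u _; rewrite -!big_split; apply: eq_bigr => v _ /=.
by rewrite eE; ring.
Qed.

End IndicatorSums.

Lemma independent_adjF (G : sgraph) (S : {set G}) x y :
  independent S -> x \in S -> y \in S -> adj x y = false.
Proof.
move=> /forall_inP/(_ x) iS xS yS; apply/negbTE.
by move/forall_inP: (iS xS); apply.
Qed.

Section Charging.
Variables (R : realType) (G : sgraph) (S : {set G}) (r s : G) (d : G -> nat).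
Variable z : G -> R.
Hypotheses (blG : block_graph G) (indS : independent S).
Hypotheses (rS : r \notin S) (sS : s \in S) (dP : bfs_depth (@adj G) r d).
Hypotheses (z0 : forall v, 0 <= z v).
Hypotheses (rmax : forall v, v \notin S -> z v <= z r).
Hypotheses (smax : forall v, v \in S -> z v <= z s).

Let adjS x y : x \in S -> y \in S -> adj x y = false.
Proof. exact: independent_adjF. Qed.

(* Ties in depth go to the endpoint outside [S]: its neighbours that are not
   deeper form a clique, so at most one of them lies in [S]. *)
Definition charged (u v : G) : bool :=
  adj u v && (if u \in S then (d v < d u)%N else (v \in S) && (d v <= d u)%N).

(** The same charging for the pineapple with clique [s |: ~: S] and centre [r]: vertices of [S]
    charge their edge to [r], the other vertices except [r] charge their edge to [s]. The edge
    between [r] and [s] is thus charged once, to [s]. *)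
Definition charged_pineapple (u v : G) : bool :=
  if u \in S then v == r else (u != r) && (v == s).

(** For [u] in [S] the other end is the unique parent; otherwise two distinct ends would be adjacent
    vertices of [S]. *)
Lemma charged_unique u v w : charged u v -> charged u w -> v = w.
Proof.
rewrite /charged; case: ifP => uS /andP[uv] => [dv | /andP[vS dv]].
  by case/andP=> uw dw; apply: (parent_unique blG dP uv uw).
case/and3P=> uw wS dw; apply/eqP/negPn/negP => vw.
by have := shallow_neighbours_adj blG dP uv uw vw dv dw; rewrite adjS.
Qed.

Lemma charged_root v : charged r v = false.
Proof.
have [d0 _ _] := dP; rewrite /charged (negPf rS) (eqP (_ : d r == 0%N)) ?d0 //.
rewrite leqn0 d0; case: (eqVneq v r) => [->|]; rewrite ?(negPf rS) ?andbF //.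
Qed.

(** The other end lies outside [S] or in [S], where [r] or [s] maximises [z]. The root is charged
    with nothing, which matches its exclusion in [charged_pineapple]. *)
Lemma charged_le u v : charged u v ->
  exists2 w, charged_pineapple u w & z v <= z w.
Proof.
have [-> | ur] := eqVneq u r; first by rewrite charged_root.
rewrite /charged /charged_pineapple ur; case: ifP => uS /andP[uv].
  exists r => //; apply: rmax; apply: contraTN uv => vS; by rewrite adjS.
by case/andP => vS _; exists s; rewrite ?eqxx ?smax.
Qed.

(** An edge meeting [S] has exactly one end in [S], and the depth test charges exactly one of its
    ends. *)
Lemma adj_charged u v :
  (adj u v)%:R = (adj u v && (u \notin S) && (v \notin S))%:R
    + (charged u v)%:R + (charged v u)%:R :> R.
Proof.
rewrite /charged [adj v u]adj_sym.
case: (boolP (u \in S)) => uS; case: (boolP (v \in S)) => vS /=.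
- by rewrite adjS //= !add0r.
- rewrite andbF /= add0r.
  by case: (adj u v); case: ltnP; rewrite /= ?addr0 ?add0r.
- rewrite andbF /= add0r.
  by case: (adj u v); case: ltnP; rewrite /= ?addr0 ?add0r.
by rewrite !andbF !andbT !addr0.
Qed.

Lemma pineapple_charged u v :
  (pineapple_rel (s |: ~: S) r u v)%:R =
  ((u != v) && (u \notin S) && (v \notin S))%:R
    + (charged_pineapple u v)%:R + (charged_pineapple v u)%:R :> R.
Proof.
have SE w : w \in S -> (w == r) = false.
  by move=> wS; apply: contraNF rS => /eqP <-.
have CE w : w \notin S -> (w == s) = false by apply: contraNF => /eqP ->.
rewrite /pineapple_rel /charged_pineapple /= !inE.
case: (boolP (u \in S)) => uS; case: (boolP (v \in S)) => vS /=.
- rewrite !SE // !orbF andbF !addr0; case: eqVneq => //= uv.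
  by case: eqVneq => //= us; rewrite -us eq_sym (negPf uv).
- have -> : u != v by apply: contraNneq vS => <-.
  rewrite SE //= ?orbT ?andbT ?orbF ?andbF add0r.
  by case: (v == r); case: (u == s); rewrite /= ?addr0 ?add0r.
- have -> : u != v by apply: contraNneq uS => ->.
  rewrite [v == r]SE //= ?orbT ?orbF ?andbT ?andbF add0r.
  by case: (u == r); case: (v == s); rewrite /= ?addr0 ?add0r.
by rewrite !CE // !orbT !andbT !andbF !addr0.
Qed.

(** The part outside [S], which is complete in the pineapple; hence the comparison with [neq]. *)
Let core (e : rel G) : rel G :=
  [rel u v | e u v && (u \notin S) && (v \notin S)].

Let neq : rel G := [rel u v | u != v].

Let quad_adj : quad_form (@adj G) z = quad_form (core (@adj G)) z +
  2 * \sum_u z u * \sum_v (charged u v)%:R * z v.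
Proof. by apply: quad_form_charged => u v; apply: adj_charged. Qed.

Let quad_pineapple : quad_form (pineapple_rel (s |: ~: S) r) z =
  quad_form (core neq) z +
  2 * \sum_u z u * \sum_v (charged_pineapple u v)%:R * z v.
Proof. by apply: quad_form_charged => u v; apply: pineapple_charged. Qed.

Let core_le u v : (core (@adj G) u v)%:R * (z u * z v) <=
                  (core neq u v)%:R * (z u * z v).
Proof.
rewrite ler_wpM2r ?mulr_ge0 // ler_nat /core /neq /=.
case: (eqVneq u v) => [->|_]; first by rewrite adj_irrefl.
by case: (adj u v) => //=; case: (_ && _).
Qed.

Let charge_le u : z u * \sum_v (charged u v)%:R * z v <=
                  z u * \sum_v (charged_pineapple u v)%:R * z v.
Proof.
rewrite ler_wpM2l //; apply: sum_indicator_le => // [v w|v].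
  exact: charged_unique.
exact: charged_le.
Qed.

Lemma quad_form_pineapple_le :
  quad_form (@adj G) z <= quad_form (pineapple_rel (s |: ~: S) r) z.
Proof.
rewrite quad_adj quad_pineapple lerD ?ler_wpM2l //.
  by apply: ler_sum => u _; apply: ler_sum => v _.
by apply: ler_sum => u _.
Qed.

(** Equality of the totals forces equality in the core and in the charges, then term by term as [z]
    is positive. Uniqueness of [s] is asked only when some vertex [u] charges an edge to [s]. *)
Lemma quad_form_pineapple_eq : (forall v, 0 < z v) ->
  (forall v, v \notin S -> z v = z r -> v = r) ->
  (forall u v, u \notin S -> u != r -> v \in S -> z v = z s -> v = s) ->
  quad_form (pineapple_rel (s |: ~: S) r) z <= quad_form (@adj G) z ->
  forall u v, adj u v = pineapple_rel (s |: ~: S) r u v.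
Proof.
move=> zp rU sU; rewrite quad_adj quad_pineapple => ge.
have le1 : quad_form (core (@adj G)) z <= quad_form (core neq) z.
  by apply: ler_sum => u _; apply: ler_sum => v _.
have le2 := ler_sum (index_enum _) (fun u (_ : true) => charge_le u).
have ge1 : quad_form (core neq) z <= quad_form (core (@adj G)) z by lra.
have ge2 : \sum_u z u * \sum_v (charged_pineapple u v)%:R * z v <=
  \sum_u z u * \sum_v (charged u v)%:R * z v by lra.
have coreE u v : core (@adj G) u v = core neq u v.
  have rowE := ler_sum_eq (fun u => ler_sum _ (fun v _ => core_le u v)) ge1 u.
  have := ler_sum_eq (core_le u) _ v; rewrite rowE => /(_ (lexx _)).
  have zz : z u * z v != 0 by rewrite mulf_neq0 ?gt_eqF.
  by move/(mulIf zz)/natr_bool_inj.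
have sumE u : \sum_v (charged u v)%:R * z v =
              \sum_v (charged_pineapple u v)%:R * z v.
  by have := ler_sum_eq charge_le ge2 u => /mulfI; apply; rewrite gt_eqF.
have chE u v : charged u v = charged_pineapple u v.
  have cpU w w' : charged_pineapple u w -> charged_pineapple u w' -> w = w'.
    rewrite /charged_pineapple; case: ifP => _; first by move=> /eqP -> /eqP ->.
    by move=> /andP[_ /eqP ->] /andP[_ /eqP ->].
  (* Equal sums give [w] the maximal value attained at [r] or [s], and unique maximisers identify
     it. *)
  have chW w : charged u w -> charged_pineapple u w.
    move=> cuw; have [w' cpw' _] := charged_le cuw.
    have := sumE u.
    rewrite (@sum_indicator_unique _ _ z (charged u) w) //; last first.
      by move=> ? ?; apply: charged_unique cuw.
    rewrite (@sum_indicator_unique _ _ z (charged_pineapple u) w') //; last first.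
      by move=> ? ?; apply: cpU cpw'.
    move: cpw' cuw; rewrite /charged_pineapple /charged; case: ifP => uS.
      move=> /eqP -> /andP[uw _] zE; apply/eqP/rU => //.
      by apply: contraTN uw => wS; rewrite adjS.
    move=> /andP[ur /eqP ->] /and3P[_ wS _] zE; rewrite ur /=.
    by apply/eqP/(sU u) => //; rewrite uS.
  apply/idP/idP => [|cp]; first exact: chW.
  (* If [u] were charged with no edge of [G], its sum would be 0, against the positive [z v] on the
     pineapple side. *)
  have [w cw | c0] := pickP (charged u).
    by rewrite (cpU v w cp (chW w cw)).
  have := sumE u; rewrite big1 => [|w _]; last by rewrite c0 mul0r.
  rewrite (@sum_indicator_unique _ _ z (charged_pineapple u) v) //.
    by move=> z0E; have := zp v; rewrite -z0E ltxx.
  by move=> ? ?; apply: cpU cp.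
move=> u v; apply/(@natr_bool_inj R).
rewrite adj_charged pineapple_charged !chE.
by have := coreE u v; rewrite /core /neq /= => ->.
Qed.

End Charging.

(** * Comparison with the pineapple *)

Lemma independence_number_witness (G : sgraph) :
  exists2 S : {set G}, independent S & #|S| = independence_number G.
Proof.
have i0 : independent (set0 : {set G}).
  by apply/forall_inP => x; rewrite inE.
have [|S iS SE] := @eq_bigmax_cond _ (@independent G) (fun S => #|S|).
  by apply/card_gt0P; exists set0.
by exists S.
Qed.

Lemma independence_number_max (G : sgraph) (S : {set G}) :
  independent S -> (#|S| <= independence_number G)%N.
Proof. exact: (@leq_bigmax_cond _ _ (fun S : {set G} => #|S|)). Qed.

Lemma independence_number_gt0 (G : sgraph) :
  (0 < #|G|)%N -> (0 < independence_number G)%N.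
Proof.
case/card_gt0P => x _; rewrite -(cards1 x) independence_number_max //.
apply/forall_inP => y /set1P ->; apply/forall_inP => z /set1P ->.
by rewrite adj_irrefl.
Qed.

Lemma independence_number1_complete (G : sgraph) (x y : G) :
  (independence_number G <= 1)%N -> x != y -> adj x y.
Proof.
move=> le1 xy; apply: contraT => nxy.
have : independent [set x; y].
  apply/forall_inP => a /set2P[]->; apply/forall_inP => b /set2P[]->;
  by rewrite ?adj_irrefl // adj_sym.
by move/independence_number_max/leq_trans/(_ le1); rewrite cards2 xy.
Qed.

Lemma connected_edgeless (G : sgraph) : connected_graph G ->
  (forall x y : G, adj x y = false) -> #|G| = 1%N.
Proof.
move=> [/card_gt0P[x _] conn] e0; apply/eqP/fintype1P; exists x => y.
have /connectP[[|z p] /=] := conn x y; first by [].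
by rewrite e0.
Qed.

Lemma edgeless_isomorphic (G : sgraph) :
  #|G| = 1%N -> isomorphic G (pineapple 1 0).
Proof.
move=> G1; have /card_gt0P[r _] : (0 < #|G|)%N by rewrite G1.
have eqr (x : G) : x = r.
  by have /fintype1P[w wE] := introT eqP G1; rewrite (wE x).
apply: (@pineapple_rel_isomorphic _ [set: G] r); rewrite ?inE ?cardsT //.
  by rewrite setCT cards0.
by move=> x y; rewrite (eqr x) (eqr y) adj_irrefl /pineapple_rel /= eqxx.
Qed.

(** For [z = |y|], the chain runs from [t] times the squared norm through the forms of [G] and of
    the pineapple to [mu] times the squared norm. *)
Lemma block_graph_eigenvalue (R : realType) (G : sgraph) (S : {set G})
    (m p : nat) (a b c mu t : R) : block_graph G -> independent S ->
  #|S| = p.+1 -> #|~: S| = m.+1 -> independence_number G = p.+1 ->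
  0 < a -> 0 < b -> 0 < c ->
  mu * a = m%:R * a + c -> mu * b = c -> mu * c = m.+1%:R * a + p%:R * b ->
  eigenvalue (adjacency_matrix R G) t ->
  t <= mu /\ (t = mu -> isomorphic G (pineapple m.+2 p)).
Proof.
move=> blG indS cS cC alphaE a0 b0 c0 muQ muI muC.
move=> /adjacency_eigenvalueP[y yA [w yw]].
pose z v := `|y v|.
have z0 v : 0 <= z v by apply: normr_ge0.
have [s0 s0S] : exists s0, s0 \in S by apply/card_gt0P; rewrite cS.
have [r0 r0S] : exists r0, r0 \in ~: S by apply/card_gt0P; rewrite cC.
have [s sS smax] : exists2 s, s \in S & forall v, v \in S -> z v <= z s.
  by case: (arg_maxP z s0S) => s sS le; exists s.
have [r rS rmax] : exists2 r, r \notin S & forall v, v \notin S -> z v <= z r.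
  case: (arg_maxP z r0S) => r rS le; exists r; first by rewrite -in_setC.
  by move=> v; rewrite -in_setC; apply: le.
have [d dP] := bfs_depth_exists (fun v => blG.1.2 r v).
pose Q := s |: ~: S; pose B := pineapple_rel Q r.
have rQ : r \in Q by rewrite !inE rS orbT.
have cQ : #|Q| = m.+2 by rewrite cardsU1 inE negbK sS cC.
have cI : #|~: Q| = p.
  apply/eqP; rewrite -(eqn_add2l #|Q|) cardsC cQ -(cardsC S) cS cC.
  by rewrite addSnnS addnC.
pose x := pineapple_weight a b c Q r.
have x0 v : 0 < x v by rewrite /x /pineapple_weight; do 2?case: ifP => _.
have xB := pineapple_weight_eigen muQ muI muC rQ cQ cI.
have y2 : \sum_u y u ^+ 2 = \sum_u z u ^+ 2.
  by apply: eq_bigr => u _; rewrite /z real_normK ?num_real.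
have y2p : 0 < \sum_u z u ^+ 2.
  rewrite (bigD1 w) //= ltr_wpDr ?exprn_even_gt0 ?normr_eq0 //.
  by apply: sumr_ge0 => u _; rewrite sqr_ge0.
have le1 : t * \sum_u z u ^+ 2 <= quad_form (@adj G) z.
  by rewrite -y2 -(eigenfunction_quad_form yA) quad_form_norm.
have le2 := quad_form_pineapple_le blG indS rS sS dP z0 rmax smax.
have le3 := rayleigh_le z (@pineapple_rel_sym _ Q r) x0 xB.
split=> [|tE].
  by rewrite -(ler_pM2r y2p) (le_trans le1) // (le_trans le2).
apply: (pineapple_rel_isomorphic rQ cQ cI).
(* Without pendant vertices [a = c], so maximisers are not unique; but then the independence number
   is 1 and both graphs are complete. *)
have [p0 | p0] := posnP p.
  move=> u v; rewrite /pineapple_rel /=.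
  have QT k : k \in Q.
    apply/negPn; rewrite -in_setC; move/eqP: cI.
    by rewrite p0 cards_eq0 => /eqP ->; rewrite inE.
  rewrite !QT andbT; case: (eqVneq u v) => [->|uv]; first by rewrite adj_irrefl.
  by rewrite (independence_number1_complete _ uv) // alphaE p0.
(* The centre is adjacent to every other vertex of the pineapple, so [z] is proportional to [x]. *)
subst t; have zx u : z u / x u = z r / x r.
  have [-> // | ur] := eqVneq u r.
  apply: (rayleigh_eq (@pineapple_rel_sym _ Q r) x0 xB (le_trans le1 le2)).
  by rewrite /pineapple_rel /= ur eqxx !orbT.
have zE u : z u = z r / x r * x u by rewrite -(zx u) divfK ?gt_eqF.
have k0 : 0 < z r / x r.
  rewrite -(pmulr_lgt0 _ (x0 w)) -zE /z normr_gt0 //.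
have zxE u v : z u = z v -> x u = x v.
  by rewrite !(zE u) !(zE v) => /mulfI; apply; rewrite gt_eqF.
apply: (quad_form_pineapple_eq blG indS rS sS dP z0 rmax smax).
- by move=> v; rewrite zE mulr_gt0.
- move=> v vS /zxE; rewrite /x /pineapple_weight eqxx !inE vS orbT.
  case: eqP => // _ ac; exfalso.
  (* If [a = c], the equations at the centre and on the clique differ by [p * b]. *)
  have pb : 0 < p%:R * b by rewrite mulr_gt0 ?ltr0n.
  by move: muC muQ; rewrite -ac -natr1; lra.
- move=> u v uS ur vS /zxE; rewrite /x /pineapple_weight !inE eqxx vS /= orbF.
  have -> : (v == r) = false by apply: contraNF rS => /eqP <-.
  have -> : (s == r) = false by apply: contraNF rS => /eqP <-.
  case: eqP => // _ ba; exfalso.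
  (* If [a = b], the clique and pendant equations give [m * a = 0], yet [u] and [r] are two vertices
     outside [S]. *)
  have m0 : (0 < m)%N.
    rewrite -ltnS -cC (cardsD1 r) !inE rS ltnS; apply/card_gt0P; exists u.
    by rewrite !inE ur uS.
  have ma : 0 < m%:R * a by rewrite mulr_gt0 ?ltr0n.
  by move: muQ muI ma; rewrite ba => -> ; lra.
by rewrite (le_trans le3).
Qed.

Theorem theorem5p6 (R : realType) (G : sgraph) (n alpha : nat)
    (hG : block_graph G) (hn : #|G| = n)
    (halpha : independence_number G = alpha) :
  rho R G <= rho R (pineapple (n - alpha + 1) (alpha - 1)) /\
  (rho R G = rho R (pineapple (n - alpha + 1) (alpha - 1)) <->
   isomorphic G (pineapple (n - alpha + 1) (alpha - 1))).
Proof.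
have [S indS cS] := independence_number_witness G.
have alpha_gt0 := independence_number_gt0 hG.1.1.
rewrite halpha in cS alpha_gt0.
have cC := cardsC S; rewrite hn cS in cC.
(* If [S] is everything, [G] is a single vertex; otherwise the clique has size [m.+2], as the
   weights require. *)
have [C0 | C_gt0] := posnP #|~: S|.
  have ST x : x \in S by apply/negPn; rewrite -in_setC (cards0_eq C0) inE.
  have G1 : #|G| = 1%N.
    by apply: connected_edgeless hG.1 _ => x y; apply: independent_adjF indS _ _.
  have -> : (n - alpha + 1 = 1)%N by lia.
  have -> : (alpha - 1 = 0)%N by lia.
  have isoG := edgeless_isomorphic G1.
  by rewrite (rho_isomorphic R isoG).
have [m mE] : exists m, #|~: S| = m.+1 by exists #|~: S|.-1; rewrite prednK.
have [p pE] : exists p, alpha = p.+1 by exists alpha.-1; rewrite prednK.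
have -> : (n - alpha + 1 = m.+2)%N by lia.
have -> : (alpha - 1 = p)%N by lia.
have [a [b [c [mu [[a0 b0 c0 mu0] muQ muI muC]]]]] :=
  pineapple_weights_exist R m p.
rewrite (pineapple_rho a0 b0 c0 muQ muI muC).
have eigG t := @block_graph_eigenvalue R G S m p a b c mu t hG indS
  (etrans cS pE) mE (etrans halpha pE) a0 b0 c0 muQ muI muC.
(* The default value 0 of [rho] is harmless: it lies strictly below [mu]. *)
have rhoG : rho R G = 0 \/ eigenvalue (adjacency_matrix R G) (rho R G).
  by rewrite /rho; case: xgetP => [r _ [rE _] | _]; [right | left].
split; first by case: rhoG => [-> | /eigG[]]; first exact: ltW.
split=> [rE | /(rho_isomorphic R) ->].
  case: rhoG => [r0 | /eigG[_ ]]; last exact.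
  by move: mu0; rewrite -rE r0 ltxx.
exact: (pineapple_rho a0 b0 c0 muQ muI muC).
Qed.
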